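(* Let $(\Omega,d)$ be a strongly finite-dimensional $*$-differential calculus of dimension $N$ over the Hopf $*$-algebra $\mathcal{A}$ associated to a compact quantum group $G$, with $\dim(\Omega^{\mathrm{inv}}_N)=1$ and $d(\Omega^{\mathrm{inv}}_{N-1})=0$; fix a graded, left-invariant inner product on $\Omega$ and a volume element $\theta\in\Omega_N^{\mathrm{inv}}$. Let $\omega_1,\dots,\omega_M$ be an orthonormal basis of $\Omega_1^{\mathrm{inv}}$, let $\chi_1,\dots,\chi_M$ be the linear functionals on $\mathcal{A}$ with $da=\sum_{r}(\chi_r*a)\omega_r$ for all $a\in\mathcal{A}$, let $c_{rs}$ be the scalars with $M_{\omega_r}M_{\omega_s}^*(\theta)=c_{rs}\theta$, and set $\gamma=\sum_{r,s=1}^Mc_{rs}\chi_r\chi_s^*$. Let $(U^\alpha)_\alpha$ be a complete family of mutually inequivalent irreducible unitary representations of $G$, with $U^\alpha$ acting on the Hilbert space $H_\alpha$ of dimension $N_\alpha$. Set $S^\alpha=(\mathrm{id}\otimes\gamma)(U^\alpha)$ and choose an orthonormal basis $e^\alpha_1,\dots,e^\alpha_{N_\alpha}$ of $H_\alpha$ making $S^\alpha$ diagonal, so that $S^\alpha e^\alpha_i=\lambda^\alpha_ie^\alpha_i$ for some $\lambda^\alpha_i\in\mathbb{C}$. Let $U^\alpha_{ij}$ be the matrix elements of $U^\alpha$ relative to this basis. Then $\nabla(U^\alpha_{ij}\theta)=\lambda^\alpha_jU^\alpha_{ij}\theta$.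
   Context: All spaces are over $\mathbb{C}$; inner products are linear in the first variable. $G=(A,\Delta)$ is a compact quantum group in the sense of Woronowicz. Its associated Hopf $*$-algebra $\mathcal{A}$ is the linear span of the matrix elements of all finite-dimensional irreducible unitary representations of $G$, with the restriction of $\Delta$; $\kappa$ is its co-inverse (antipode), and $h$ its (positive, faithful) Haar integral. A unitary representation $U^\alpha\in B(H_\alpha)\otimes\mathcal{A}$ has matrix elements satisfying $\Delta(U^\alpha_{ij})=\sum_kU^\alpha_{ik}\otimes U^\alpha_{kj}$; $(\mathrm{id}\otimes\gamma)(U^\alpha)$ is the operator with matrix $(\gamma(U^\alpha_{ij}))$. The operator $S^\alpha$ is positive, hence diagonalisable in an orthonormal basis. A graded $*$-algebra is an algebra $\Omega=\bigoplus_{n\ge 0}\Omega_n$ with $\Omega_m\Omega_n\subseteq\Omega_{m+n}$ and a conjugate-linear degree-zero map $\omega\mapsto\omega^*$ with $(\omega^* )^*=\omega$ and $(\omega_1\omega_2)^*=(-1)^{kl}\omega_2^*\omega_1^*$ for $\omega_1\in\Omega_k,\omega_2\in\Omega_l$. A graded $*$-differential algebra is a pair $(\Omega,d)$ with $\Omega$ a graded $*$-algebra and $d$ a linear map of degree $1$ with $d^2=0$, $d(\omega^* )=(d\omega)^*$ and $d(\omega'\omega)=d(\omega')\omega+(-1)^k\omega'd\omega$ for $\omega'\in\Omega_k$. A $*$-differential calculus over $\mathcal{A}$ is a graded $*$-differential algebra $(\Omega,d)$ such that: (1) $\Omega_0=\mathcal{A}$ as $*$-algebras and $\Omega_k$ ($k>0$)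 is the linear span of products $a_0\,da_1\cdots da_k$, $a_i\in\mathcal{A}$; (2) there is an algebra homomorphism $\Delta_\Omega:\Omega\to\mathcal{A}\otimes\Omega$ extending $\Delta$ with $(\mathrm{id}_{\mathcal{A}}\otimes d)\Delta_\Omega=\Delta_\Omega d$; (3) $d1=0$. $\Omega^{\mathrm{inv}}=\{\omega:\Delta_\Omega(\omega)=1\otimes\omega\}$, $\Omega^{\mathrm{inv}}_k=\Omega_k\cap\Omega^{\mathrm{inv}}$; $a\otimes\omega\mapsto a\omega$ is an isomorphism of left $\mathcal{A}$-modules $\mathcal{A}\otimes\Omega^{\mathrm{inv}}\to\Omega$. The calculus is strongly finite dimensional if $\dim\Omega^{\mathrm{inv}}<\infty$; its dimension is the $N$ with $\Omega_N\ne0$, $\Omega_k=0$ for $k>N$. An inner product on $\Omega$ is graded if the $\Omega_k$ are pairwise orthogonal, and left-invariant if $(a\omega\mid b\eta)=h(b^*a)(\omega\mid\eta)$ for $a,b\in\mathcal{A}$, $\omega,\eta\in\Omega^{\mathrm{inv}}$. Then $d$ has an adjoint $d^*$ on $\Omega$, and the Laplacian is $\nabla=(d+d^* )^2=dd^*+d^*d$. A volume element is a unit vector $\theta\in\Omega_N^{\mathrm{inv}}$ with $\theta^*=\theta$. For $\omega\in\Omega_1^{\mathrm{inv}}$, $M_\omega$ is the operator $\eta\mapsto\omega\eta$ on the finite-dimensional inner product space $\Omega^{\mathrm{inv}}$. For linear functionals $f,g,\chi$ on $\mathcal{A}$: $\chi*a=(\mathrm{id}\otimes\chi)\Delta(a)$,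 $(fg)(a)=(f\otimes g)\Delta(a)$, $\chi^*(a)=\overline{\chi(\kappa(a)^* )}$. *)

(* Defs.v *)
From HB Require Import structures.
From mathcomp Require Import all_boot all_order all_algebra.
From mathcomp Require Import generic_quotient.
From mathcomp Require Import boolp classical_sets.
From mathcomp Require Import complex.
Set Implicit Arguments.
Unset Strict Implicit.
Unset Printing Implicit Defensive.
Import Order.TTheory GRing.Theory Num.Theory.
Local Open Scope classical_set_scope.
Local Open Scope quotient_scope.
Local Open Scope ring_scope.

Definition is_bilinear (K : comNzRingType) (V W U : lmodType K)
    (f : V -> W -> U) : Prop :=
  (forall w, linear (f^~ w)) /\ (forall v, linear (f v)).

(* V (x) W is the set of finite sums of formal tensors, two of them being
   identified when no bilinear map, with values in any module, separates them. *)
Section Tensor.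
Context {K : comNzRingType}.
Implicit Types V W U : lmodType K.

Definition tsum V W U (f : V -> W -> U) (s : seq (V * W)) : U :=
  \sum_(p <- s) f p.1 p.2.

Definition tens_rel V W : rel (seq (V * W)) := fun s t =>
  `[< forall U (f : V -> W -> U), is_bilinear f -> tsum f s = tsum f t >].

Lemma tens_rel_refl V W : reflexive (@tens_rel V W).
Proof. by move=> s; apply/asboolP. Qed.

Lemma tens_rel_sym V W : symmetric (@tens_rel V W).
Proof. by move=> s t; apply/asboolP/asboolP => st U f ?; rewrite st. Qed.

Lemma tens_rel_trans V W : transitive (@tens_rel V W).
Proof.
move=> t s r /asboolP st /asboolP tr; apply/asboolP => U f bf.
by rewrite st // tr.
Qed.

Canonical tens_equiv V W := EquivRel (@tens_rel V W)
  (@tens_rel_refl V W) (@tens_rel_sym V W) (@tens_rel_trans V W).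

Definition tens V W : Type := {eq_quot (@tens_equiv V W)}.

HB.instance Definition _ V W := Choice.on (tens V W).
HB.instance Definition _ V W := EqQuotient.on (tens V W).

Definition pure V W (v : V) (w : W) : tens V W := \pi_(tens V W) [:: (v, w)].

(* Meaningful only when f is bilinear; see tlift_pure and tlift_linear. *)
Definition tlift V W U (f : V -> W -> U) (x : tens V W) : U := tsum f (repr x).

Lemma tlift_pi V W U (f : V -> W -> U) (s : seq (V * W)) :
  is_bilinear f -> tlift f (\pi_(tens V W) s) = tsum f s.
Proof.
move=> bf; rewrite /tlift; case: piP => t /eqmodP /asboolP st.
by rewrite st.
Qed.

Lemma tens_sep V W (x y : tens V W) :
  (forall U (f : V -> W -> U), is_bilinear f -> tlift f x = tlift f y) -> x = y.
Proof.
move=> xy; rewrite -[x]reprK -[y]reprK; apply/eqmodP/asboolP => U f bf.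
exact: xy.
Qed.

Definition tzero V W : tens V W := \pi_(tens V W) [::].
Definition tadd V W (x y : tens V W) : tens V W :=
  \pi_(tens V W) (repr x ++ repr y).
Definition tscale V W (c : K) (x : tens V W) : tens V W :=
  \pi_(tens V W) [seq (c *: p.1, p.2) | p <- repr x].
Definition topp V W (x : tens V W) : tens V W := tscale (-1) x.

Lemma bilZl V W U (f : V -> W -> U) c v w :
  is_bilinear f -> f (c *: v) w = c *: f v w.
Proof.
move=> [/(_ w) fl _]; have f0 : f 0 w = 0.
  have := fl (-1) 0 0; rewrite scaler0 addr0 scaleN1r addNr; exact.
by have := fl c v 0; rewrite !addr0 f0 addr0.
Qed.

Lemma tlift0 V W U (f : V -> W -> U) : is_bilinear f -> tlift f (tzero V W) = 0.
Proof. by move=> bf; rewrite tlift_pi // /tsum big_nil. Qed.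

Lemma tliftD V W U (f : V -> W -> U) x y : is_bilinear f ->
  tlift f (tadd x y) = tlift f x + tlift f y.
Proof. by move=> bf; rewrite tlift_pi // /tsum big_cat. Qed.

Lemma tliftZ V W U (f : V -> W -> U) c x : is_bilinear f ->
  tlift f (tscale c x) = c *: tlift f x.
Proof.
move=> bf; rewrite tlift_pi // /tlift /tsum big_map scaler_sumr.
by apply: eq_bigr => p _; rewrite bilZl.
Qed.

Lemma taddA V W : associative (@tadd V W).
Proof. by move=> x y z; apply: tens_sep => U f bf; rewrite !tliftD // addrA. Qed.

Lemma taddC V W : commutative (@tadd V W).
Proof. by move=> x y; apply: tens_sep => U f bf; rewrite !tliftD // addrC. Qed.

Lemma tadd0 V W : left_id (tzero V W) (@tadd V W).
Proof.
by move=> x; apply: tens_sep => U f bf; rewrite !tliftD // tlift0 // add0r.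
Qed.

Lemma taddN V W : left_inverse (tzero V W) (@topp V W) (@tadd V W).
Proof.
move=> x; apply: tens_sep => U f bf.
by rewrite !tliftD // tliftZ // tlift0 // scaleN1r addNr.
Qed.

HB.instance Definition _ V W := GRing.isZmodule.Build (tens V W)
  (@taddA V W) (@taddC V W) (@tadd0 V W) (@taddN V W).

Lemma tscaleA V W a b (x : tens V W) :
  tscale a (tscale b x) = tscale (a * b) x.
Proof. by apply: tens_sep => U f bf; rewrite !tliftZ // scalerA. Qed.

Lemma tscale1 V W : left_id 1 (@tscale V W).
Proof. by move=> x; apply: tens_sep => U f bf; rewrite !tliftZ // scale1r. Qed.

Lemma tscaleDr V W : right_distributive (@tscale V W) +%R.
Proof.
by move=> c x y; apply: tens_sep => U f bf; rewrite !(tliftD, tliftZ) // scalerDr.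
Qed.

Lemma tscaleDl V W (x : tens V W) :
  {morph (fun c => tscale c x) : a b / a + b}.
Proof.
by move=> a b; apply: tens_sep => U f bf; rewrite !(tliftD, tliftZ) // scalerDl.
Qed.

HB.instance Definition _ V W := GRing.Zmodule_isLmodule.Build K (tens V W)
  (@tscaleA V W) (@tscale1 V W) (@tscaleDr V W) (@tscaleDl V W).

Lemma tlift_linear V W U (f : V -> W -> U) :
  is_bilinear f -> linear (tlift f).
Proof. by move=> bf c x y; rewrite tliftD // tliftZ. Qed.

Lemma tlift_pure V W U (f : V -> W -> U) v w :
  is_bilinear f -> tlift f (pure v w) = f v w.
Proof. by move=> bf; rewrite tlift_pi // /tsum big_seq1. Qed.

Lemma pure_bilinear V W : is_bilinear (@pure V W).
Proof.
split=> [w c u v|v c u w]; apply: tens_sep => U f bf;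
  by rewrite tliftD // tliftZ // !tlift_pure //; case: bf => fl fr;
     rewrite ?fl ?fr.
Qed.

Lemma pi_tsum V W (s : seq (V * W)) : \pi_(tens V W) s = tsum (@pure V W) s.
Proof.
elim: s => [|p s IHs]; first by rewrite /tsum big_nil.
rewrite /tsum big_cons -/(tsum _ s) -IHs; apply: tens_sep => U f bf.
by rewrite tliftD // tlift_pure // !tlift_pi // /tsum big_cons.
Qed.

Lemma tens_repr V W (x : tens V W) : x = \sum_(p <- repr x) pure p.1 p.2.
Proof. by rewrite -[LHS]reprK pi_tsum. Qed.

Lemma tens_ext V W U (f g : tens V W -> U) : linear f -> linear g ->
  (forall v w, f (pure v w) = g (pure v w)) -> f =1 g.
Proof.
move=> fl gl fg x; rewrite (tens_repr x).
pose F := GRing.isLinear.Build _ _ _ _ f fl.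
pose fL : {linear tens V W -> U} := HB.pack f F.
pose G := GRing.isLinear.Build _ _ _ _ g gl.
pose gL : {linear tens V W -> U} := HB.pack g G.
rewrite -[f]/(fL : _ -> _) -[g]/(gL : _ -> _) !linear_sum.
by apply: eq_bigr => p _; apply: fg.
Qed.

Definition tmap V W V' W' (f : V -> V') (g : W -> W') : tens V W -> tens V' W' :=
  tlift (fun v w => pure (f v) (g w)).

Definition tassoc V W U : tens (tens V W) U -> tens V (tens W U) :=
  tlift (fun x u => tlift (fun v w => pure v (pure w u)) x).

(* The functional f (x) g, with K (x) K identified with K. *)
Definition tfun V W (f : V -> K) (g : W -> K) : tens V W -> K :=
  tlift (U := K^o) (fun v w => f v * g w).

End Tensor.

Notation "v \ox w" := (pure v w) (at level 40, left associativity) : ring_scope.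

Section TensorAlgebra.
Context {K : comNzRingType} {A B : algType K}.

Definition tmul (x y : tens A B) : tens A B :=
  tlift (fun a b => tlift (fun a' b' => (a * a') \ox (b * b')) y) x.

Let pureDl (b : B) : linear (fun a : A => a \ox b).
Proof. exact: (pure_bilinear _ _).1. Qed.
Let pureDr (a : A) : linear (fun b : B => a \ox b).
Proof. exact: (pure_bilinear _ _).2. Qed.

Lemma tmul_bil_in a b :
  is_bilinear (fun (a' : A) (b' : B) => (a * a') \ox (b * b')).
Proof.
by split=> [w c u v|v c u w];
  rewrite mulrDr -scalerAr ?(pureDl _ c) ?(pureDr _ c).
Qed.

Lemma tmul_bil_out (y : tens A B) : is_bilinear
  (fun a b => tlift (fun a' b' => (a * a') \ox (b * b')) y).
Proof.
split=> [w c u v|v c u w].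
  rewrite /tlift /tsum scaler_sumr -big_split; apply: eq_bigr => p _ /=.
  by rewrite mulrDl -scalerAl pureDl.
rewrite /tlift /tsum scaler_sumr -big_split; apply: eq_bigr => p _ /=.
by rewrite mulrDl -scalerAl pureDr.
Qed.

Lemma tmul_pure a b a' b' :
  tmul (a \ox b) (a' \ox b') = (a * a') \ox (b * b').
Proof.
by rewrite /tmul tlift_pure ?tlift_pure //;
   [exact: tmul_bil_in | exact: tmul_bil_out].
Qed.

Lemma tmul_linl y : linear (tmul^~ y).
Proof. exact/tlift_linear/tmul_bil_out. Qed.

Lemma tmul_linr x : linear (tmul x).
Proof.
move=> c y z; rewrite /tmul [LHS]/tlift [in RHS]/tlift /tsum.
rewrite [X in _ = _ *: X + _](_ : _ = \sum_(p <- repr x)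
  tlift (fun a' b' => (p.1 * a') \ox (p.2 * b')) y) //.
rewrite scaler_sumr -big_split; apply: eq_bigr => p _ /=.
exact/tlift_linear/tmul_bil_in.
Qed.

Let linB (U V : lmodType K) (f g : U -> V) c : linear f -> linear g ->
  linear (fun x => c *: f x + g x).
Proof.
move=> fl gl a x y; rewrite fl gl !scalerDr !scalerA [c * a]mulrC !addrA.
by congr (_ + _); rewrite -!addrA; congr (_ + _); rewrite addrC.
Qed.

Lemma tmulA : associative tmul.
Proof.
move=> x y z.
apply: (tens_ext (f := fun x => tmul x (tmul y z))
  (g := fun x => tmul (tmul x y) z)).
- exact: tmul_linl.
- by move=> c u v; rewrite tmul_linl tmul_linl.
move=> a b.
apply: (tens_ext (f := fun y => tmul (a \ox b) (tmul y z))
  (g := fun y => tmul (tmul (a \ox b) y) z)).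
- by move=> c u v; rewrite tmul_linl tmul_linr.
- by move=> c u v; rewrite tmul_linr tmul_linl.
move=> a' b'.
apply: (tens_ext (f := fun z => tmul (a \ox b) (tmul (a' \ox b') z))
  (g := fun z => tmul (tmul (a \ox b) (a' \ox b')) z)).
- by move=> c u v; rewrite !tmul_linr.
- exact: tmul_linr.
by move=> a'' b''; rewrite !tmul_pure !mulrA.
Qed.

Lemma tmul1 : left_id (1 \ox 1) tmul.
Proof.
apply: (tens_ext (g := id)) => [|//|a b]; first exact: tmul_linr.
by rewrite tmul_pure !mul1r.
Qed.

Lemma tmulr1 : right_id (1 \ox 1) tmul.
Proof.
move=> x; apply: (tens_ext (f := tmul^~ _) (g := id)) => [|//|a b].
  exact: tmul_linl.
by rewrite tmul_pure !mulr1.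
Qed.

Lemma tmulDl : left_distributive tmul +%R.
Proof. by move=> x y z; have := tmul_linl z 1 x y; rewrite !scale1r. Qed.

Lemma tmulDr : right_distributive tmul +%R.
Proof. by move=> x y z; have := tmul_linr x 1 y z; rewrite !scale1r. Qed.

HB.instance Definition _ := GRing.Zmodule_isPzRing.Build (tens A B)
  tmulA tmul1 tmulr1 tmulDl tmulDr.

End TensorAlgebra.

HB.mixin Record isStarAlgebra (C : numClosedFieldType) A
    of GRing.Algebra C A := {
  star : A -> A;
  starK : involutive star;
  starD : {morph star : a b / a + b};
  starZ : forall (c : C) a, star (c *: a) = c^* *: star a;
  starM : forall a b, star (a * b) = star b * star a
}.

#[short(type="starAlgType")]
HB.structure Definition StarAlgebra (C : numClosedFieldType) :=
  {A of GRing.Algebra C A & isStarAlgebra C A}.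

(* The norm is a nonnegative element of C, as for the normed modules over C of
   the library; these cannot be joined with noncommutative rings. *)
HB.mixin Record isCStarAlgebra (C : numClosedFieldType) A
    of StarAlgebra C A := {
  cnorm : A -> C;
  cnorm_ge0 : forall a, 0 <= cnorm a;
  cnorm_eq0 : forall a, cnorm a = 0 -> a = 0;
  cnormD : forall a b, cnorm (a + b) <= cnorm a + cnorm b;
  cnormZ : forall (c : C) a, cnorm (c *: a) = `|c| * cnorm a;
  cnormM : forall a b, cnorm (a * b) <= cnorm a * cnorm b;
  cnorm_star : forall a, cnorm (star a * a) = cnorm a ^+ 2;
  cnorm_complete : forall x : nat -> A,
    (forall e : C, 0 < e -> exists n, forall k l, (n <= k)%N -> (n <= l)%N ->
      cnorm (x k - x l) < e) ->
    exists y, forall e : C, 0 < e -> exists n, forall k, (n <= k)%N ->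
      cnorm (x k - y) < e
}.

#[short(type="cstarAlgType")]
HB.structure Definition CStarAlgebra (C : numClosedFieldType) :=
  {A of StarAlgebra C A & isCStarAlgebra C A}.

Definition norm_dense (C : numClosedFieldType) (A : cstarAlgType C)
    (P : set A) : Prop :=
  forall a (e : C), 0 < e -> exists2 b, P b & cnorm (a - b) < e.

Definition star_hom (C : numClosedFieldType) (A B : starAlgType C)
    (f : A -> B) : Prop :=
  [/\ linear f, monoid_morphism f & forall a, f (star a) = star (f a)].

(* The involution (a (x) b)^* = a^* (x) b^*; it is conjugate-linear, hence not
   an instance of tlift. *)
Definition tstar (C : numClosedFieldType) (A B : starAlgType C)
    (x : tens A B) : tens A B :=
  \sum_(p <- repr x) star p.1 \ox star p.2.

(* Used only to show that tstar is well defined. *)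
Definition conjmod (C : numClosedFieldType) (U : lmodType C) : Type := U.

Section ConjugateModule.
Context {C : numClosedFieldType} {U : lmodType C}.
HB.instance Definition _ := GRing.Zmodule.on (conjmod U).

Definition cscale (c : C) (x : conjmod U) : conjmod U := c^* *: (x : U).

Lemma cscaleA a b x : cscale a (cscale b x) = cscale (a * b) x.
Proof. by rewrite /cscale scalerA rmorphM. Qed.
Lemma cscale1 : left_id 1 cscale.
Proof. by move=> x; rewrite /cscale rmorph1 scale1r. Qed.
Lemma cscaleDr : right_distributive cscale +%R.
Proof. by move=> c x y; rewrite /cscale scalerDr. Qed.
Lemma cscaleDl x : {morph cscale^~ x : a b / a + b}.
Proof. by move=> a b; rewrite /cscale rmorphD scalerDl. Qed.

HB.instance Definition _ := GRing.Zmodule_isLmodule.Build C (conjmod U)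
  cscaleA cscale1 cscaleDr cscaleDl.
End ConjugateModule.

Section TensorStar.
Context {C : numClosedFieldType} {A B : starAlgType C}.

Lemma star_bil (U : lmodType C) (f : A -> B -> U) : is_bilinear f ->
  is_bilinear (U := conjmod U) (fun a b => f (star a) (star b)).
Proof.
move=> [fl fr]; split=> [w c u v|v c u w] /=.
  by rewrite starD starZ fl.
by rewrite starD starZ fr.
Qed.

Lemma tlift_tstar (U : lmodType C) (f : A -> B -> U) (x : tens A B) :
  is_bilinear f -> tlift f (tstar x) =
    tlift (U := conjmod U) (fun a b => f (star a) (star b)) x.
Proof.
move=> bf; rewrite /tstar [RHS]/tlift /tsum.
elim: (repr x) => [|p s IHs]; first by rewrite !big_nil [LHS]tlift0.
by rewrite !big_cons [LHS]tliftD // tlift_pure // IHs.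
Qed.

Lemma tstar_pure (a : A) (b : B) : tstar (a \ox b) = star a \ox star b.
Proof.
apply: tens_sep => U f bf; rewrite tlift_tstar // !tlift_pure //.
exact: star_bil.
Qed.

Lemma tstarD : {morph @tstar C A B : x y / x + y}.
Proof.
move=> x y; apply: tens_sep => U f bf.
by rewrite [RHS]tliftD // !tlift_tstar // tliftD //; apply: star_bil.
Qed.

End TensorStar.

Definition lspan (C : nzRingType) (V : lmodType C) (P : set V) : set V :=
  [set v | exists s : seq (C * V),
    (forall p, p \in s -> P p.2) /\ v = \sum_(p <- s) p.1 *: p.2].

Definition is_state (C : numClosedFieldType) (A : starAlgType C)
    (phi : {scalar A}) : Prop :=
  (forall a, 0 <= phi (star a * a)) /\ phi 1 = 1.

(* T, with the map i, is the minimal (spatial) tensor product of the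
   C*-algebras A and B: the completion of the algebraic tensor product for
   ||x||^2 = sup (phi (x) psi)(y^* x^* x y), over the states phi of A and psi
   of B and the y with (phi (x) psi)(y^* y) = 1. This is the supremum of the
   norms of x in the tensor products of the GNS representations. *)
Definition is_min_tensor (C : numClosedFieldType) (A B T : cstarAlgType C)
    (i : tens A B -> T) : Prop :=
  [/\ linear i, monoid_morphism i, (forall x, i (tstar x) = star (i x)),
      (forall x, supremums
        [set z : C | exists (phi : {scalar A}) (psi : {scalar B}) y,
          [/\ is_state phi, is_state psi, tfun phi psi (tstar y * y) = 1
            & z = tfun phi psi (tstar y * (tstar x * x) * y)]]
        (cnorm (i x) ^+ 2))
    & norm_dense (range i)].

Record compact_quantum_group (C : numClosedFieldType) := CompactQuantumGroup {
  cqg :> cstarAlgType C;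
  cqg2 : cstarAlgType C;
  cqg3 : cstarAlgType C;
  cqg_in2 : tens cqg cqg -> cqg2;
  cqg_in2P : is_min_tensor cqg_in2;
  cqg_in3 : tens cqg2 cqg -> cqg3;
  cqg_in3P : is_min_tensor cqg_in3;
  cqg_comul : cqg -> cqg2;
  cqg_comulP : star_hom cqg_comul;
  (* Delta (x) id, x |-> 1 (x) x, and id (x) Delta, which being
     *-homomorphisms are determined by their values on elementary tensors *)
  cqg_comul_id : cqg2 -> cqg3;
  cqg_comul_idP : star_hom cqg_comul_id /\ forall a b,
    cqg_comul_id (cqg_in2 (a \ox b)) = cqg_in3 (cqg_comul a \ox b);
  cqg_in23 : cqg2 -> cqg3;
  cqg_in23P : star_hom cqg_in23 /\ forall a b,
    cqg_in23 (cqg_in2 (a \ox b)) = cqg_in3 (cqg_in2 (1 \ox a) \ox b);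
  cqg_id_comul : cqg2 -> cqg3;
  cqg_id_comulP : star_hom cqg_id_comul /\ forall a b,
    cqg_id_comul (cqg_in2 (a \ox b)) =
      cqg_in3 (cqg_in2 (a \ox 1) \ox 1) * cqg_in23 (cqg_comul b);
  cqg_coassoc : forall a,
    cqg_comul_id (cqg_comul a) = cqg_id_comul (cqg_comul a);
  cqg_cancell : norm_dense (lspan
    [set x | exists a b, x = cqg_in2 (a \ox 1) * cqg_comul b]);
  cqg_cancelr : norm_dense (lspan
    [set x | exists a b, x = cqg_in2 (1 \ox a) * cqg_comul b])
}.

Section Representations.
Context {C : numClosedFieldType} {A : starAlgType C}.

Definition scalar_mx_in m n (p : 'M[C]_(m, n)) : 'M[A]_(m, n) :=
  map_mx (fun c => c%:A) p.

Definition is_unitary n (u : 'M[A]_n) : Prop :=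
  let us := (map_mx star u)^T in u *m us = 1%:M /\ us *m u = 1%:M.

(* i is the embedding of the algebraic tensor product into the codomain of
   the comultiplication D. *)
Definition unitary_rep (T : Type) (i : tens A A -> T) (D : A -> T) n
    (u : 'M[A]_n) : Prop :=
  is_unitary u /\ forall j k, D (u j k) = i (\sum_l u j l \ox u l k).

(* No subspace of C^n other than 0 and C^n is invariant; a subspace is given
   as the image of an idempotent p, and is invariant when u p = p u p. *)
Definition is_irreducible n (u : 'M[A]_n) : Prop :=
  (0 < n)%N /\ forall p : 'M[C]_n, p *m p = p ->
    u *m scalar_mx_in p = scalar_mx_in p *m u *m scalar_mx_in p ->
    p = 0 \/ p = 1%:M.

Definition rep_equivalent m n (u : 'M[A]_m) (v : 'M[A]_n) : Prop :=
  exists (x : 'M[C]_(m, n)) (y : 'M[C]_(n, m)),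
    [/\ x *m y = 1%:M, y *m x = 1%:M
      & u *m scalar_mx_in x = scalar_mx_in x *m v].

(* The matrix elements of u in the orthonormal basis e of C^n. *)
Definition mx_in_basis n (e : 'I_n -> 'cV[C]_n) (u : 'M[A]_n) : 'M[A]_n :=
  \matrix_(i, j) \sum_k \sum_l ((e i k 0)^* * e j l 0) *: u k l.

End Representations.

Record hopf_star_algebra (C : numClosedFieldType) := HopfStarAlgebra {
  hopf :> starAlgType C;
  comul : hopf -> tens hopf hopf;
  counit : hopf -> C;
  antipode : hopf -> hopf;
  comul_linear : linear comul;
  comulM : monoid_morphism comul;
  comul_star : forall a, comul (star a) = tstar (comul a);
  comulA : forall a,
    tassoc (tmap comul id (comul a)) = tmap id comul (comul a);
  counit_linear : scalar counit;
  counitM : monoid_morphism counit;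
  counitl : forall a, tlift (fun b c => counit b *: c) (comul a) = a;
  counitr : forall a, tlift (fun b c => counit c *: b) (comul a) = a;
  antipode_linear : linear antipode;
  antipodel : forall a,
    tlift (fun b c => antipode b * c) (comul a) = (counit a)%:A;
  antipoder : forall a,
    tlift (fun b c => b * antipode c) (comul a) = (counit a)%:A
}.
Arguments comul {C h}.
Arguments counit {C h}.
Arguments antipode {C h}.

Definition irr_unitary_rep (C : numClosedFieldType) (H : hopf_star_algebra C)
    n (u : 'M[H]_n) : Prop :=
  unitary_rep id comul u /\ is_irreducible u.

Record is_hopf_algebra_of (C : numClosedFieldType)
    (G : compact_quantum_group C) (H : hopf_star_algebra C) (j : H -> G)
    : Prop := IsHopfAlgebraOf {
  hopf_of_hom : star_hom j;
  hopf_of_inj : injective j;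
  hopf_of_range : range j = lspan [set a : G | exists n (u : 'M[G]_n) k l,
    [/\ unitary_rep (@cqg_in2 _ G) (@cqg_comul _ G) u, is_irreducible u
      & a = u k l]];
  hopf_of_comul : forall a,
    cqg_comul (j a) = cqg_in2 (tmap j j (comul a))
}.

Section Functionals.
Context {C : numClosedFieldType} {H : hopf_star_algebra C}.
Implicit Types f g chi : H -> C.

Definition is_haar_integral (h : H -> C) : Prop :=
  [/\ scalar h, h 1 = 1,
      (forall a, tlift (fun b c => h b *: c) (comul a) = (h a)%:A /\
                 tlift (fun b c => h c *: b) (comul a) = (h a)%:A),
      (forall a, 0 <= h (star a * a))
    & (forall a, h (star a * a) = 0 -> a = 0)].

Definition fact chi (a : H) : H := tlift (fun b c => chi c *: b) (comul a).
Definition fmul f g : H -> C := fun a => tfun f g (comul a).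
Definition fstar chi : H -> C := fun a => (chi (star (antipode a)))^*.

End Functionals.

(* The Hilbert space of the representation al is C^(dim al), with its standard
   inner product. *)
Definition complete_family (C : numClosedFieldType) (H : hopf_star_algebra C)
    (I : Type) (dim : I -> nat) (U : forall al, 'M[H]_(dim al)) : Prop :=
  [/\ forall al, irr_unitary_rep (U al),
      forall al be, al <> be -> ~ rep_equivalent (U al) (U be)
    & forall n (u : 'M[H]_n), irr_unitary_rep u ->
        exists al, rep_equivalent u (U al)].

Section InnerProducts.
Context {C : numClosedFieldType} {V : lmodType C}.
Implicit Types (ip : V -> V -> C) (P : set V).

Definition inner_product ip : Prop :=
  [/\ forall y, scalar (ip^~ y), forall x y, ip y x = (ip x y)^*
    & forall x, x != 0 -> 0 < ip x x].

Definition orthonormal_basis P ip n (b : 'I_n -> V) : Prop :=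
  [/\ forall i, P (b i), forall i j, ip (b i) (b j) = (i == j)%:R
    & forall v, P v -> exists c : 'I_n -> C, v = \sum_i c i *: b i].

(* On the subspace P, g is the adjoint of f; the values of g outside P are
   irrelevant. *)
Definition is_adjoint P ip (f g : V -> V) : Prop :=
  (forall x, P x -> P (g x)) /\
  (forall x y, P x -> P y -> ip (f x) y = ip x (g y)).

Definition has_dim P n : Prop := exists b : 'I_n -> V,
  [/\ forall i, P (b i),
      forall v, P v -> exists c : 'I_n -> C, v = \sum_i c i *: b i
    & forall c : 'I_n -> C, \sum_i c i *: b i = 0 -> forall i, c i = 0].

End InnerProducts.

Definition cv_ip (C : numClosedFieldType) n (x y : 'cV[C]_n) : C :=
  \sum_k x k 0 * (y k 0)^*.

Record graded_star_diff_algebra (C : numClosedFieldType) := GradedStarDiffAlg {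
  form_alg :> algType C;
  deg : nat -> set form_alg;
  fconj : form_alg -> form_alg;
  extd : form_alg -> form_alg;
  deg_submod : forall n,
    deg n 0 /\ forall c x y, deg n x -> deg n y -> deg n (c *: x + y);
  deg_span : forall w, exists n (x : nat -> form_alg),
    (forall k, deg k (x k)) /\ w = \sum_(k < n) x k;
  deg_direct : forall n (x : nat -> form_alg), (forall k, deg k (x k)) ->
    \sum_(k < n) x k = 0 -> forall k, (k < n)%N -> x k = 0;
  degM : forall m n x y, deg m x -> deg n y -> deg (m + n) (x * y);
  fconj_deg : forall n x, deg n x -> deg n (fconj x);
  fconjD : {morph fconj : x y / x + y};
  fconjZ : forall (c : C) x, fconj (c *: x) = c^* *: fconj x;
  fconjK : involutive fconj;
  fconjM : forall k l x y, deg k x -> deg l y ->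
    fconj (x * y) = (-1) ^+ (k * l) *: (fconj y * fconj x);
  extd_linear : linear extd;
  extd_deg : forall n x, deg n x -> deg n.+1 (extd x);
  extd_extd : forall x, extd (extd x) = 0;
  extd_conj : forall x, extd (fconj x) = fconj (extd x);
  extdM : forall k x y, deg k x ->
    extd (x * y) = extd x * y + (-1) ^+ k *: (x * extd y)
}.
Arguments deg {C g}.
Arguments fconj {C g}.
Arguments extd {C g}.

Record star_diff_calculus (C : numClosedFieldType) (H : hopf_star_algebra C) :=
    StarDiffCalculus {
  calc :> graded_star_diff_algebra C;
  incl : H -> calc;
  incl_linear : linear incl;
  inclM : monoid_morphism incl;
  incl_star : forall a, incl (star a) = fconj (incl a);
  incl_inj : injective incl;
  deg0 : deg 0 = range incl;
  degS : forall k, deg k.+1 = lspan [set w | exists a0 (a : k.+1.-tuple H),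
    w = incl a0 * \prod_(b <- a) extd (incl b)];
  coact : calc -> tens H calc;
  coact_linear : linear coact;
  coactM : monoid_morphism coact;
  coact_incl : forall a, coact (incl a) = tmap id incl (comul a);
  coact_extd : forall w, coact (extd w) = tmap id extd (coact w);
  extd1 : extd (1 : calc) = 0
}.
Arguments incl {C H s}.
Arguments coact {C H s}.

Section Calculus.
Context {C : numClosedFieldType} {H : hopf_star_algebra C}.
Variable Om : star_diff_calculus H.
Implicit Types ip : Om -> Om -> C.

Definition inv_forms : set Om := [set w | coact w = 1 \ox w].
Definition inv_forms_deg k : set Om := deg k `&` inv_forms.

Definition strongly_finite_dim : Prop := exists n, has_dim inv_forms n.

Definition calc_dim (N : nat) : Prop :=
  (exists2 w : Om, deg N w & w != 0) /\
  (forall k, (N < k)%N -> forall w : Om, deg k w -> w = 0).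

Definition graded_ip ip : Prop :=
  forall k l x y, k <> l -> deg k x -> deg l y -> ip x y = 0.

Definition left_invariant_ip (h : H -> C) ip : Prop :=
  forall a b w e, inv_forms w -> inv_forms e ->
    ip (incl a * w) (incl b * e) = h (star b * a) * ip w e.

Definition volume_element N ip (theta : Om) : Prop :=
  [/\ inv_forms_deg N theta, ip theta theta = 1 & fconj theta = theta].

Definition laplacian (dstar : Om -> Om) (w : Om) : Om :=
  let D x := extd x + dstar x in D (D w).

End Calculus.
Arguments inv_forms {C H} Om.
Arguments inv_forms_deg {C H} Om k.

(* Main.v *)
(* The Haar integral satisfies h(x b1) b2 = h(x1 b) S^-1(x2) (in Sweedler
   notation), so for the inner product h(b^* a) the operator chi^* * _ is adjoint
   to chi * _. Omega is spanned by the products a eta with eta homogeneous and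
   invariant, and a deta is orthogonal to the top degree, whence
     d^*(a theta) = sum_s (chi_s^* * a) (M_s^* theta).
   Each M_s^* theta is invariant and orthogonal to all degrees except N - 1, hence
   closed, so applying d yields (gamma * a) theta. This is the Laplacian of
   a theta, since d(a theta) = 0 and d^* d^* = 0; and gamma * _ acts on the matrix
   elements of a representation U through the matrix gamma(U). *)
Require Import Defs.
From HB Require Import structures.
From mathcomp Require Import all_boot all_order all_algebra.
From mathcomp Require Import boolp classical_sets reals complex.
Set Implicit Arguments.
Unset Strict Implicit.
Unset Printing Implicit Defensive.
Import Order.TTheory GRing.Theory Num.Theory.
Local Open Scope classical_set_scope.
Local Open Scope ring_scope.

(** * Linearity given as a hypothesis on a bare function *)

Section LinearFunctions.
Context {K : comNzRingType} {V W : lmodType K} (f : V -> W) (lf : linear f).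

Let F := GRing.isLinear.Build _ _ _ _ f lf.
Let fL : {linear V -> W} := HB.pack f F.

Lemma linear_at0 : f 0 = 0. Proof. exact: (linear0 fL). Qed.
Lemma linear_atD u v : f (u + v) = f u + f v. Proof. exact: (linearD fL). Qed.
Lemma linear_atZ a u : f (a *: u) = a *: f u.
Proof. exact: (linearZ_LR fL). Qed.
Lemma linear_at_sum (I : Type) (r : seq I) (P : pred I) (E : I -> V) :
  f (\sum_(i <- r | P i) E i) = \sum_(i <- r | P i) f (E i).
Proof. exact: (linear_sum fL). Qed.
End LinearFunctions.

(** * Computing with sums over elementary tensors *)

Section TensorSums.
Context {K : comNzRingType}.

(** Since [tlift] is a finite sum over one chosen representative of [x], a linear map passes through
    it without bilinearity of [f]. This permits integrands that are bilinear only after a later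
    rewriting. *)
Lemma linear_tlift (V W U U' : lmodType K) (g : U -> U') (f : V -> W -> U) x :
  linear g -> g (tlift f x) = tlift (fun v w => g (f v w)) x.
Proof. by move=> lg; rewrite /tlift /tsum linear_at_sum. Qed.

Lemma eq_tlift (V W U : lmodType K) (f g : V -> W -> U) x :
  (forall v w, f v w = g v w) -> tlift f x = tlift g x.
Proof. by move=> fg; apply: eq_bigr => p _. Qed.

Lemma exchange_tlift (V W V' W' U : lmodType K) (f : V -> W -> V' -> W' -> U)
    x y :
  tlift (fun v w => tlift (f v w) y) x =
  tlift (fun v' w' => tlift (fun v w => f v w v' w') x) y.
Proof. exact: exchange_big. Qed.

Lemma tlift_sum (V W U : lmodType K) (f : V -> W -> U) (I : Type) (r : seq I)
    (E : I -> tens V W) : is_bilinear f ->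
  tlift f (\sum_(i <- r) E i) = \sum_(i <- r) tlift f (E i).
Proof. by move=> bf; rewrite linear_at_sum //; apply: tlift_linear. Qed.

Lemma tlift_tmap (V W V' W' U : lmodType K) (k : V' -> W' -> U)
    (f : V -> V') (g : W -> W') x : is_bilinear k ->
  tlift k (tmap f g x) = tlift (fun v w => k (f v) (g w)) x.
Proof.
move=> bk; rewrite {1}/tmap (linear_tlift _ _ (tlift_linear bk)).
by apply: eq_tlift => v w; rewrite tlift_pure.
Qed.

Lemma tlift_mul (A B : algType K) (U : lmodType K) (f : A -> B -> U)
    (x y : tens A B) : is_bilinear f ->
  tlift f (x * y) =
  tlift (fun a b => tlift (fun a' b' => f (a * a') (b * b')) y) x.
Proof.
move=> bf; have lf := tlift_linear bf.
rewrite -[x * y]/(tmul x y) /tmul (linear_tlift _ _ lf).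
apply: eq_tlift => a b; rewrite (linear_tlift _ _ lf).
by apply: eq_tlift => a' b'; rewrite tlift_pure.
Qed.

Lemma tmap_pure (V W V' W' : lmodType K) (f : V -> V') (g : W -> W') v w :
  linear f -> linear g -> tmap f g (v \ox w) = f v \ox g w.
Proof.
move=> lf lg; rewrite /tmap tlift_pure //; split=> [w' c u v'|v' c u w'].
  by rewrite lf (pure_bilinear _ _).1.
by rewrite lg (pure_bilinear _ _).2.
Qed.

End TensorSums.

(** Both sides are sums over the same representative of [x], because [tstar] is itself defined from
    [repr x]. The integrand on the right is in general only conjugate-linear. *)
Lemma tlift_tstar_sum (C : numClosedFieldType) (A B : starAlgType C)
    (U : lmodType C) (f : A -> B -> U) (x : tens A B) : is_bilinear f ->
  tlift f (tstar x) = tlift (fun a b => f (star a) (star b)) x.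
Proof.
move=> bf; rewrite /tstar tlift_sum //.
by apply: eq_bigr => p _; rewrite tlift_pure.
Qed.

(** * Sweedler calculus in a Hopf *-algebra *)

Section HopfSums.
Context {C : numClosedFieldType} {H : hopf_star_algebra C}.

(** Coassociativity in Sweedler form: a trilinear [F] factors through the triple tensor product, so
    the axiom [comulA] gives one meaning to the sum of F(x1, x2, x3). *)
Lemma comul_coassoc (U : lmodType C) (F : H -> H -> H -> U) (x : H) :
  (forall b c, linear (fun a => F a b c)) ->
  (forall a c, linear (fun b => F a b c)) ->
  (forall a b, linear (fun c => F a b c)) ->
  tlift (fun y c => tlift (fun a b => F a b c) (comul y)) (comul x) =
  tlift (fun a y => tlift (fun b c => F a b c) (comul y)) (comul x).
Proof.
move=> F1 F2 F3.
have bF a : is_bilinear (F a) by split.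
have bF' c : is_bilinear (fun a b => F a b c) by split.
have bG : is_bilinear (fun a z => tlift (F a) z).
  split=> [z c a a'|a]; last exact: tlift_linear.
  rewrite /tlift /tsum scaler_sumr -big_split; apply: eq_bigr => p _ /=.
  exact: F1.
have bT : is_bilinear (fun z c => tlift (fun a b => F a b c) z).
  split=> [c|z c a a']; first exact: tlift_linear.
  rewrite /tlift /tsum scaler_sumr -big_split; apply: eq_bigr => p _ /=.
  exact: F3.
transitivity (tlift (fun a z => tlift (F a) z)
    (tassoc (tmap comul id (comul x)))); last first.
  by rewrite comulA tlift_tmap.
rewrite -(tlift_tmap _ _ _ bT) /tassoc (linear_tlift _ _ (tlift_linear bG)).
apply: eq_tlift => z c; rewrite (linear_tlift _ _ (tlift_linear bG)).
by apply: eq_tlift => a b; rewrite !tlift_pure.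
Qed.

Lemma scalar_fact (chi : H -> C) (lchi : scalar chi) :
  is_bilinear (fun b c : H => chi c *: b).
Proof.
split=> [c a b b'|b a c c']; first by rewrite scalerDr !scalerA mulrC.
by rewrite lchi scalerDl scalerA.
Qed.

Lemma fact_linear (chi : H -> C) : scalar chi -> linear (fact chi).
Proof.
move=> lchi a x y; rewrite /fact comul_linear.
by rewrite tlift_linear //; apply: scalar_fact.
Qed.

Lemma fact_sum (I : Type) (r : seq I) (f : I -> H -> C) a :
  fact (fun x => \sum_(i <- r) f i x) a = \sum_(i <- r) fact (f i) a.
Proof.
rewrite /fact /tlift /tsum exchange_big; apply: eq_bigr => p _.
by rewrite scaler_suml.
Qed.

Lemma fact_scale k (f : H -> C) a :
  fact (fun x => k * f x) a = k *: fact f a.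
Proof.
rewrite /fact /tlift /tsum scaler_sumr; apply: eq_bigr => p _.
by rewrite scalerA.
Qed.

Lemma scalar_sum (I : Type) (r : seq I) (f : I -> H -> C) :
  (forall i, scalar (f i)) -> scalar (fun x => \sum_(i <- r) f i x).
Proof.
move=> lf k x y; rewrite mulr_sumr -big_split.
by apply: eq_bigr => i _; rewrite lf.
Qed.

Lemma scalar_scale k (f : H -> C) : scalar f -> scalar (fun x => k * f x).
Proof. by move=> lf l x y; rewrite lf mulrDr mulrCA. Qed.

(** By coassociativity both sides are the sum of f(a2) g(a3) a1. *)
Lemma fact_fmul (f g : H -> C) a : scalar f -> scalar g ->
  fact (fmul f g) a = fact f (fact g a).
Proof.
move=> lf lg; rewrite [fact g a]/fact (linear_tlift _ _ (fact_linear lf)).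
pose F (u v w : H) : H := (f v * g w) *: u.
transitivity (tlift (fun b z => tlift (F b) (comul z)) (comul a)).
  apply: eq_tlift => b z; rewrite /fmul /tfun /tlift /tsum scaler_suml.
  by apply: eq_bigr.
rewrite -comul_coassoc; first last.
- by move=> u v c w w'; rewrite /F lg scalerA -scalerDl mulrDr mulrCA.
- by move=> u w c v v'; rewrite /F lf scalerA -scalerDl mulrDl mulrA.
- by move=> v w c u u'; rewrite /F scalerDr !scalerA mulrC.
apply: eq_tlift => b c; rewrite linear_atZ; last exact: fact_linear.
rewrite /fact /tlift /tsum scaler_sumr; apply: eq_bigr => p _.
by rewrite /F scalerA mulrC.
Qed.

Lemma fmul_scalar (f g : H -> C) : scalar f -> scalar g -> scalar (fmul f g).
Proof.
move=> lf lg a x y; rewrite /fmul comul_linear.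
apply: (tlift_linear (U := C^o)); split=> [w c u v|v c u w].
  by rewrite lf mulrDl -mulrA.
by rewrite lg mulrDr mulrCA.
Qed.

Lemma fstar_scalar (f : H -> C) : scalar f -> scalar (fstar f).
Proof.
move=> lf a x y; rewrite /fstar antipode_linear starD starZ lf.
by rewrite rmorphD rmorphM /= conjCK.
Qed.

Lemma star0 : star (0 : H) = 0.
Proof. by apply: (addrI (star 0)); rewrite -starD !addr0. Qed.

Lemma star_sum (I : Type) (r : seq I) (E : I -> H) :
  star (\sum_(i <- r) E i) = \sum_(i <- r) star (E i).
Proof. exact: (big_morph (star : H -> H) starD star0). Qed.

Lemma star1 : star (1 : H) = 1.
Proof. by rewrite -[LHS]mul1r -[X in X * _]starK -starM mul1r starK. Qed.

(** In a Hopf *-algebra this is the inverse of the antipode. In this form it meets [fstar] directly: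
    [chi (antipode_inv (star a))] is the conjugate of [fstar chi a]. *)
Definition antipode_inv (x : H) : H := star (antipode (star x)).

Lemma antipode_inv_linear : linear antipode_inv.
Proof.
move=> a x y; rewrite /antipode_inv starD starZ antipode_linear starD starZ.
by rewrite conjCK.
Qed.

(** This is the star of the axiom [antipoder] at [star x]; the involution reverses products, which
    puts the second leg in front of the first. *)
Lemma antipode_inv_swap (x : H) :
  tlift (fun b c => antipode_inv c * b) (comul x) = ((counit (star x))^*)%:A.
Proof.
rewrite -{1}[x]starK comul_star tlift_tstar_sum; last first.
  split=> [w c u v|v c u w]; first by rewrite mulrDr -scalerAr.
  by rewrite antipode_inv_linear mulrDl -scalerAl.
rewrite -[RHS](_ : star (counit (star x))%:A = _); last first.
  by rewrite starZ star1.
rewrite -antipoder /tlift /tsum star_sum; apply: eq_bigr => p _.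
by rewrite starM /antipode_inv starK.
Qed.

(** The star of [counitr] at [star x]. The functional is the one produced by [antipode_inv_swap], so
    the two identities can be chained. *)
Lemma conj_counitr (x : H) :
  tlift (fun b c => (counit (star c))^* *: b) (comul x) = x.
Proof.
rewrite -{1}[x]starK comul_star tlift_tstar_sum; last first.
  apply: scalar_fact => c u v.
  by rewrite starD starZ counit_linear rmorphD rmorphM /= conjCK.
rewrite -[RHS]starK -[in RHS](counitr (star x)) /tlift /tsum star_sum.
by apply: eq_bigr => p _; rewrite starZ starK.
Qed.

(** * Adjoints of convolution operators for the Haar inner product *)

Section Haar.
Variables (h : H -> C) (Hh : is_haar_integral h).

Let lh : scalar h. Proof. by case: Hh. Qed.

(* Both sides equal the sum of h(x1 b1) S^-1(x3) x2 b2. *)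
Lemma haar_strong_invariance (x b : H) :
  tlift (fun b1 b2 => h (x * b1) *: b2) (comul b) =
  tlift (fun x1 x2 => h (x1 * b) *: antipode_inv x2) (comul x).
Proof.
have hD u v : h (u + v) = h u + h v := linear_atD (W := C^o) lh u v.
have hZ c u : h (c *: u) = c * h u := linear_atZ (W := C^o) lh c u.
pose F u v w : H :=
  tlift (fun b1 b2 => h (u * b1) *: (antipode_inv w * v * b2)) (comul b).
transitivity (tlift (fun x1 y => tlift (F x1) (comul y)) (comul x)).
  (* First a counit factor is inserted in the second leg of [x], then [antipode_inv_swap] spreads it
     over a second and a third leg. *)
  transitivity (tlift (fun x1 y => tlift (fun b1 b2 =>
      h ((counit (star y))^* *: x1 * b1) *: b2) (comul b)) (comul x)).
    rewrite exchange_tlift; apply: eq_tlift => b1 b2.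
    rewrite -{1}[x]conj_counitr /tlift /tsum mulr_suml.
    by rewrite (linear_at_sum (W := C^o) lh) scaler_suml.
  apply: eq_tlift => x1 y; rewrite exchange_tlift; apply: eq_tlift => b1 b2.
  rewrite -scalerAl hZ mulrC -scalerA -[in LHS](mul1r b2).
  rewrite (scalerAl _ _ b2) -antipode_inv_swap /tlift /tsum mulr_suml.
  by rewrite scaler_sumr.
rewrite -comul_coassoc; first last.
- move=> u v c w w'; rewrite /F /tlift /tsum scaler_sumr -big_split.
  apply: eq_bigr => p _ /=; rewrite antipode_inv_linear !mulrDl scalerDr.
  by rewrite -!scalerAl !scalerA mulrC.
- move=> u w c v v'; rewrite /F /tlift /tsum scaler_sumr -big_split.
  apply: eq_bigr => p _ /=; rewrite mulrDr mulrDl scalerDr.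
  by rewrite -scalerAr -!scalerAl !scalerA mulrC.
- move=> v w c u u'; rewrite /F /tlift /tsum scaler_sumr -big_split.
  by apply: eq_bigr => p _ /=; rewrite mulrDl -scalerAl hD hZ scalerDl scalerA.
apply: eq_tlift => y w.
(* Invariance of [h] on its first leg, at [y * b]; multiplicativity of [comul] then splits the legs
   of the product. *)
have [_ _ /(_ (y * b))[inv _] _ _] := Hh.
rewrite -[in RHS](mulr1 (antipode_inv w)) scalerAr -inv.
rewrite (comulM H).2 tlift_mul; last first.
  split=> [v c u u'|u c v v']; first by rewrite lh scalerDl scalerA.
  by rewrite scalerDr !scalerA mulrC.
rewrite /F /tlift /tsum mulr_sumr; apply: eq_bigr => p _.
by rewrite mulr_sumr; apply: eq_bigr => q _; rewrite -scalerAr mulrA.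
Qed.

(** Apply [chi] to strong invariance at [star a]: the values of [chi] on [antipode_inv] of the
    starred second legs of [a] are conjugates of values of [fstar chi]. *)
Lemma fact_adjoint (chi : H -> C) (a b : H) : scalar chi ->
  h (star a * fact chi b) = h (star (fact (fstar chi) a) * b).
Proof.
move=> lchi.
have hZ c u : h (c *: u) = c * h u := linear_atZ (W := C^o) lh c u.
have chiZ c u : chi (c *: u) = c * chi u := linear_atZ (W := C^o) lchi c u.
have bF : is_bilinear (fun x1 x2 : H => h (x1 * b) *: antipode_inv x2).
  split=> [w c u v|v c u w].
    by rewrite mulrDl -scalerAl lh scalerDl scalerA.
  by rewrite antipode_inv_linear scalerDr !scalerA mulrC.
have := congr1 chi (haar_strong_invariance (star a) b).
rewrite comul_star tlift_tstar_sum // !(linear_tlift (U' := C^o) _ _ lchi).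
rewrite /fact /tlift /tsum star_sum mulr_sumr mulr_suml.
rewrite !(linear_at_sum (W := C^o) lh) => strong.
rewrite (eq_bigr (fun p => chi (h (star a * p.1) *: p.2))); last first.
  by move=> p _; rewrite chiZ -scalerAr hZ mulrC.
rewrite [LHS]strong; apply: eq_bigr => p _.
by rewrite chiZ starZ -scalerAl hZ mulrC /fstar conjCK /antipode_inv starK.
Qed.

End Haar.

End HopfSums.

(** * Submodules and linear spans as sets *)

Section LinearSpans.
Context {K : nzRingType} {V : lmodType K}.
Implicit Types P Q : set V.

Definition submodule Q : Prop :=
  Q 0 /\ forall a x y, Q x -> Q y -> Q (a *: x + y).

Lemma submodule_sum Q (I : Type) (r : seq I) (E : I -> V) :
  submodule Q -> (forall i, Q (E i)) -> Q (\sum_(i <- r) E i).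
Proof.
move=> [Q0 Ql] QE; apply: (big_ind Q) => // x y Qx Qy.
by rewrite -[x]scale1r; apply: Ql.
Qed.

Lemma lspan_submodule P : submodule (lspan P).
Proof.
split; first by exists [::]; rewrite big_nil.
move=> a _ _ [s [Ps ->]] [t [Pt ->]].
exists ([seq (a * p.1, p.2) | p <- s] ++ t); split=> [p|].
  by rewrite mem_cat => /orP[/mapP[q /Ps Pq ->]|/Pt].
rewrite big_cat big_map scaler_sumr; congr (_ + _).
by apply: eq_bigr => p _; rewrite scalerA.
Qed.

Lemma lspan_gen P v : P v -> lspan P v.
Proof.
move=> Pv; exists [:: (1, v)]; rewrite big_seq1 scale1r; split=> // p.
by rewrite inE => /eqP ->.
Qed.

(** Serves as the induction principle for spans, with [Q] the set of vectors having the property to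
    be proved. *)
Lemma lspan_sub P Q : submodule Q -> P `<=` Q -> lspan P `<=` Q.
Proof.
move=> [Q0 Ql] PQ _ [s [Ps ->]]; elim: s Ps => [|p s IHs] Ps.
  by rewrite big_nil.
rewrite big_cons; apply: Ql; first by apply/PQ/Ps/mem_head.
by apply: IHs => q qs; apply: Ps; rewrite inE qs orbT.
Qed.

End LinearSpans.

Lemma submodule_preim (K : nzRingType) (V W : lmodType K) (f : W -> V)
    (Q : set V) :
  linear f -> submodule Q -> submodule [set x | Q (f x)].
Proof.
move=> lf [Q0 Ql]; split=> [|a x y Qx Qy] /=; last by rewrite lf; apply: Ql.
by have := lf (-1) 0 0; rewrite scaler0 addr0 scaleN1r addNr => ->.
Qed.

(** * Generation of all forms by invariant forms over the Hopf algebra *)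

Section Calculus.
Context {C : numClosedFieldType} {H : hopf_star_algebra C}.
Variable Om : star_diff_calculus H.

Definition inv_generated k : set Om := lspan
  [set w | exists a eta, inv_forms_deg Om k eta /\ w = incl a * eta].

Let mulr_lin (w : Om) : linear (fun x => x * w).
Proof. by move=> a x y; rewrite mulrDl scalerAl. Qed.
Let mull_lin (w : Om) : linear (fun x => w * x).
Proof. by move=> a x y; rewrite mulrDr scalerAr. Qed.

Lemma inv_formsM : forall x y, inv_forms Om x -> inv_forms Om y ->
  inv_forms Om (x * y).
Proof.
move=> x y; rewrite /inv_forms /= (coactM Om).2 => -> ->.
by rewrite -[LHS]/(tmul _ _) tmul_pure mul1r.
Qed.

Lemma inv_forms_extd x : inv_forms Om x -> inv_forms Om (extd x).
Proof.
rewrite /inv_forms /= coact_extd => ->.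
by rewrite tmap_pure //; apply: extd_linear.
Qed.

Lemma incl_deg0 (a : H) : deg 0 (incl a : Om).
Proof. by rewrite deg0; exists a. Qed.

Lemma inv_forms_degM k l x y : inv_forms_deg Om k x -> inv_forms_deg Om l y ->
  inv_forms_deg Om (k + l) (x * y).
Proof. by move=> [kx ix] [ly iy]; split; [apply: degM|apply: inv_formsM]. Qed.

Lemma inv_generated1 : inv_generated 0 1.
Proof.
apply: lspan_gen; exists 1, 1; rewrite (inclM Om).1 mulr1; split=> //; split.
  by rewrite -(inclM Om).1; apply: incl_deg0.
exact: (coactM Om).1.
Qed.

Lemma inv_generated_mull k (a : H) x :
  inv_generated k x -> inv_generated k (incl a * x).
Proof.
move: x; apply: lspan_sub.
  exact: submodule_preim (mull_lin _) (lspan_submodule _).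
move=> _ [b [eta [ieta ->]]]; apply: lspan_gen; exists (a * b), eta.
by rewrite (inclM Om).2 mulrA.
Qed.

Variables (M : nat) (omega : 'I_M -> Om) (chi : 'I_M -> H -> C).
Hypothesis omega_inv : forall r, inv_forms_deg Om 1 (omega r).
Hypothesis extd_incl : forall a : H,
  extd (incl a : Om) = \sum_r incl (fact (chi r) a) * omega r.

Lemma deg1_generated : deg 1 `<=` inv_generated 1.
Proof.
rewrite degS; apply: lspan_sub; first exact: lspan_submodule.
move=> _ [a [b ->]]; apply: inv_generated_mull.
case/tupleP: b => b s; rewrite (tuple0 s) big_seq1 extd_incl.
apply: submodule_sum; first exact: lspan_submodule.
by move=> r; apply: lspan_gen; exists (fact (chi r) b), (omega r).
Qed.

(** For y = b eta the coefficient [b] is absorbed into [x]: the product x b is again a 1-form, hence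
    a sum of terms a xi with xi invariant, and xi eta is invariant. No explicit commutation rule
    between functions and invariant forms enters. *)
Lemma generatedM k x y : deg 1 x -> inv_generated k y ->
  inv_generated k.+1 (x * y).
Proof.
move=> dx; move: y; apply: lspan_sub.
  exact: submodule_preim (mull_lin _) (lspan_submodule _).
move=> _ [b [eta [ieta ->]]] /=; rewrite mulrA.
have: inv_generated 1 (x * incl b).
  by apply: deg1_generated; rewrite -[1%N]addn0; apply/degM/incl_deg0.
move: (x * incl b); apply: lspan_sub.
  exact: submodule_preim (mulr_lin _) (lspan_submodule _).
move=> _ [a [xi [ixi ->]]] /=; rewrite -mulrA; apply: lspan_gen.
by exists a, (xi * eta); split=> //; apply: (inv_forms_degM ixi ieta).
Qed.

(** The spanning products a0 da1 ... dak are built up from 1 by left multiplication with the 1-forms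
    da, each handled by [generatedM]. *)
Lemma deg_generated k : deg k `<=` inv_generated k.
Proof.
case: k => [|k]; last first.
  rewrite degS; apply: lspan_sub; first exact: lspan_submodule.
  (* The degree becomes the length of [s], so that it varies along the induction on the list. *)
  move=> _ [a [s ->]]; apply: inv_generated_mull; rewrite -{1}(size_tuple s).
  elim: (tval s) => [|b t IHt].
    by rewrite big_nil; apply: inv_generated1.
  by rewrite big_cons; apply: generatedM => //; apply/extd_deg/incl_deg0.
rewrite deg0 => _ [a _ <-]; rewrite -[incl a]mulr1.
exact/inv_generated_mull/inv_generated1.
Qed.

Lemma forms_generated (Q : set Om) : submodule Q ->
  (forall k a eta, inv_forms_deg Om k eta -> Q (incl a * eta)) ->
  forall x, Q x.
Proof.
move=> sQ Qgen x; have [n [y [dy ->]]] := deg_span x.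
apply: submodule_sum => // k; have := deg_generated (dy k).
by apply: lspan_sub => // _ [a [eta [ieta ->]]]; apply: Qgen ieta.
Qed.

(** * The adjoint of d and the Laplacian in top degree *)

Section Metric.
Variables (h : H -> C) (N : nat) (ip : Om -> Om -> C).
Hypotheses (Hh : is_haar_integral h) (HN : calc_dim Om N).
Hypothesis Hclosed :
  forall n (w : Om), n.+1 = N -> inv_forms_deg Om n w -> extd w = 0.
Hypotheses (Hip : inner_product ip) (Hgr : graded_ip ip).
Hypothesis Hleft : left_invariant_ip h ip.
Variables (dstar : Om -> Om) (Hdstar : is_adjoint setT ip extd dstar).
Variables (theta : Om) (Htheta : inv_forms_deg Om N theta).
Hypothesis Hchi : forall r, scalar (chi r).
Variable Mstar : 'I_M -> Om -> Om.
Hypothesis HMstar : forall r,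
  is_adjoint (inv_forms Om) ip (fun eta => omega r * eta) (Mstar r).

Lemma ip_linl y : linear (fun x => ip x y : C^o).
Proof. by case: Hip => + _ _; apply. Qed.

Lemma ip_conj x y : ip y x = (ip x y)^*.
Proof. by case: Hip. Qed.

Lemma ip_eq0 x : ip x x = 0 -> x = 0.
Proof.
move=> x0; apply/eqP/contraT; have [_ _ pos] := Hip.
by move=> /pos; rewrite x0 ltxx.
Qed.

Lemma ip_sumr (I : Type) (r : seq I) (E : I -> Om) x :
  ip x (\sum_(i <- r) E i) = \sum_(i <- r) ip x (E i).
Proof.
rewrite ip_conj (linear_at_sum (ip_linl x)) rmorph_sum.
by apply: eq_bigr => i _; rewrite /= -ip_conj.
Qed.

Lemma ipBr x y z : ip x (y - z) = ip x y - ip x z.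
Proof.
have l := ip_linl x.
rewrite ip_conj (linear_atD l) -scaleN1r (linear_atZ l) scaleN1r.
by rewrite rmorphB /= -!ip_conj.
Qed.

Lemma ip_inj y z : (forall x, ip x y = ip x z) -> y = z.
Proof.
by move=> yz; apply/subr0_eq/ip_eq0; rewrite ipBr yz subrr.
Qed.

Lemma dstar_dstar x : dstar (dstar x) = 0.
Proof.
apply: ip_inj => y; rewrite -(Hdstar.2 y) // -(Hdstar.2 (extd y)) //.
rewrite extd_extd (linear_at0 (ip_linl _)) ip_conj.
by rewrite (linear_at0 (ip_linl _)) conjC0.
Qed.

Lemma extd_mul_incl (a : H) w :
  extd (incl a * w : Om) =
  \sum_r incl (fact (chi r) a) * (omega r * w) + incl a * extd w.
Proof.
rewrite (extdM _ (incl_deg0 a)) expr0 scale1r extd_incl mulr_suml.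
by congr (_ + _); apply: eq_bigr => r _; rewrite mulrA.
Qed.

Lemma Mstar_ip r eta : inv_forms Om eta ->
  ip eta (Mstar r theta) = ip (omega r * eta) theta.
Proof. by move=> ieta; case: (HMstar r) => _ ->; last case: Htheta. Qed.

Lemma Mstar_inv r : inv_forms Om (Mstar r theta).
Proof. by case: (HMstar r) => + _; apply; case: Htheta. Qed.

(** For x = a eta, left invariance leaves a multiple of the pairing of [omega r * eta] with [theta],
    whose degrees k + 1 and N differ. *)
Lemma Mstar_orth r k x : k.+1 <> N -> deg k x -> ip x (Mstar r theta) = 0.
Proof.
move=> kN /deg_generated; move: x; apply: lspan_sub.
  split=> [|a x y /= x0 y0]; first exact: (linear_at0 (ip_linl _)).
  by rewrite (ip_linl _) x0 y0 scaler0 addr0.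
move=> _ [a [eta [[deta ieta] ->]]] /=.
(* The coefficient [incl 1] is supplied to match the form required by left invariance. *)
rewrite -[Mstar r theta]mul1r -(inclM Om).1 Hleft //; last exact: Mstar_inv.
rewrite Mstar_ip // (Hgr kN _ Htheta.1) ?mulr0 //.
exact: (degM (omega_inv r).1).
Qed.

Lemma extd_Mstar r : extd (Mstar r theta) = 0.
Proof.
have [n [y [dy def]]] := deg_span (Mstar r theta).
have y0 k : (k < n)%N -> k.+1 <> N -> y k = 0.
  (* By gradedness the component [y k] pairs with the whole sum exactly as with itself, and the
     former pairing is zero. *)
  move=> kn kN; apply: ip_eq0; rewrite -(Mstar_orth r kN (dy k)) def ip_sumr.
  rewrite (bigD1 (Ordinal kn)) //= big1 ?addr0 // => i ik.
  by apply: Hgr (dy k) (dy i) => ki; rewrite -val_eqE /= ki eqxx in ik.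
(* For N = 0 there is no degree N - 1, while [N.-1] would be 0; here every component vanishes, as no
   k satisfies k + 1 = N. *)
case: (N =P 0%N) => [N0|N0].
  rewrite def big1 => [|k _]; first exact: (linear_at0 (@extd_linear _ Om)).
  by apply: y0; rewrite // N0.
apply: (Hclosed (n := N.-1)); first by rewrite prednK // lt0n; apply/eqP.
split; last exact: Mstar_inv.
rewrite def; apply: submodule_sum => [|k]; first exact: deg_submod.
have [kN|kN] := k.+1 =P N; first by rewrite -kN; apply: dy.
by rewrite y0 //; case: (deg_submod Om N.-1).
Qed.

(** Both sides are tested against b eta with eta homogeneous and invariant. Left invariance splits
    each pairing into a Haar factor and an invariant factor; [fact_adjoint] moves [chi r] in the
    first, and [Mstar_ip] moves [omega r] in the second. *)
Lemma dstar_top (a : H) : dstar (incl a * theta) =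
  \sum_r incl (fact (fstar (chi r)) a) * Mstar r theta.
Proof.
apply: ip_inj => x; rewrite -Hdstar.2 // ip_sumr; move: x.
apply: forms_generated => [|k b eta [deta ieta]] /=.
  split=> [|c x y /= xE yE].
    rewrite (linear_at0 (@extd_linear _ Om)) (linear_at0 (ip_linl _)).
    rewrite big1 // => r _; exact: (linear_at0 (ip_linl _)).
  rewrite (@extd_linear _ Om) (ip_linl _) xE yE scaler_sumr -big_split.
  by apply: eq_bigr => r _; rewrite (ip_linl _).
(* Either k + 1 = N and eta is closed by [Hclosed], or the degrees of d eta and [theta] differ. *)
have exact_orth : ip (extd eta) theta = 0.
  have [kN|kN] := k.+1 =P N; last exact: Hgr kN (extd_deg deta) Htheta.1.
  by rewrite (Hclosed kN) ?(linear_at0 (ip_linl _)).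
rewrite extd_mul_incl (linear_atD (ip_linl _)) (linear_at_sum (ip_linl _)).
rewrite (Hleft b a (inv_forms_extd ieta) Htheta.2) exact_orth mulr0 addr0.
apply: eq_bigr => r _; rewrite (Hleft _ _ ieta (Mstar_inv r)) Mstar_ip //.
rewrite (Hleft _ _ (inv_formsM (omega_inv r).2 ieta) Htheta.2).
by rewrite (fact_adjoint Hh).
Qed.

Lemma laplacian_top (c : 'I_M -> 'I_M -> C) (a : H) :
  (forall r s, omega r * Mstar s theta = c r s *: theta) ->
  laplacian dstar (incl a * theta) =
  incl (\sum_r \sum_s c r s *: fact (fmul (chi r) (fstar (chi s))) a) * theta.
Proof.
move=> Hc; rewrite /laplacian.
(* This form would have degree N + 1, beyond the dimension. *)
rewrite [extd (incl a * theta)](_ : _ = 0); last first.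
  apply: (HN.2 N.+1) => //; rewrite -[N]add0n; apply: extd_deg.
  by apply: degM Htheta.1; apply: incl_deg0.
rewrite add0r dstar_dstar addr0 dstar_top (linear_at_sum (@extd_linear _ Om)).
rewrite (linear_at_sum (@incl_linear _ _ Om)) mulr_suml.
(* Only the Leibniz term differentiating the coefficient survives; it brings in the factor
   [omega r], which meets [Mstar s theta] and produces [c r s]. *)
under eq_bigr => s _ do rewrite extd_mul_incl extd_Mstar mulr0 addr0.
rewrite exchange_big; apply: eq_bigr => r _.
rewrite (linear_at_sum (@incl_linear _ _ Om)) mulr_suml; apply: eq_bigr => s _.
rewrite Hc (linear_atZ (@incl_linear _ _ Om)) fact_fmul //.
  by rewrite -scalerAl -scalerAr.
exact: fstar_scalar.
Qed.

End Metric.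
End Calculus.

(** * Convolution on matrix elements of a representation *)

Lemma fact_mx_in_basis (C : numClosedFieldType) (H : hopf_star_algebra C)
    (gamma : H -> C) n (u : 'M[H]_n) (e : 'I_n -> 'cV[C]_n) (lambda : 'I_n -> C)
    i k : scalar gamma ->
  (forall j k, comul (u j k) = \sum_l u j l \ox u l k) ->
  map_mx gamma u *m e k = lambda k *: e k ->
  fact gamma (mx_in_basis e u i k) = lambda k *: mx_in_basis e u i k.
Proof.
move=> lg Du /matrixP ek.
rewrite !mxE (linear_at_sum (fact_linear lg)) scaler_sumr.
apply: eq_bigr => p _; rewrite (linear_at_sum (fact_linear lg)) scaler_sumr.
(* Convolving the entries of [u] with gamma gives the matrix product of [u] with gamma(u), the
   latter on the right; hence it acts on the column vector [e k]. *)
transitivity (\sum_l \sum_m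
    (((e i p 0)^* * (gamma (u m l) * e k l 0)) *: u p m)).
  apply: eq_bigr => l _; rewrite (linear_atZ (fact_linear lg)) /fact Du.
  rewrite tlift_sum ?scaler_sumr; last exact: scalar_fact.
  apply: eq_bigr => m _; rewrite tlift_pure; last exact: scalar_fact.
  by rewrite scalerA -mulrA [e k l 0 * _]mulrC.
(* With the sum over [l] innermost, it is coordinate [m] of gamma(u) applied to [e k], to which the
   eigenvalue equation applies. *)
rewrite exchange_big; apply: eq_bigr => m _.
have := ek m 0; rewrite !mxE => ekm.
rewrite -scaler_suml -mulr_sumr scalerA mulrCA -ekm; congr (_ * _ *: _).
by apply: eq_bigr => l _; rewrite mxE.
Qed.

Theorem theorem5p8 (R : realType)
    (G : compact_quantum_group R[i]) (H : hopf_star_algebra R[i])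
    (j : H -> G) (Hj : is_hopf_algebra_of j)
    (h : H -> R[i]) (Hh : is_haar_integral h)
    (Om : star_diff_calculus H) (N : nat)
    (Hfin : strongly_finite_dim Om) (HN : calc_dim Om N)
    (Htop : has_dim (inv_forms_deg Om N) 1)
    (Hclosed : forall (n : nat) (w : Om), n.+1 = N -> inv_forms_deg Om n w -> extd w = 0)
    (ip : Om -> Om -> R[i]) (Hip : inner_product ip)
    (Hgr : graded_ip ip) (Hleft : left_invariant_ip h ip)
    (dstar : Om -> Om) (Hdstar : is_adjoint setT ip extd dstar)
    (theta : Om) (Htheta : volume_element N ip theta)
    (M : nat) (omega : 'I_M -> Om)
    (Homega : orthonormal_basis (inv_forms_deg Om 1) ip omega)
    (chi : 'I_M -> H -> R[i]) (Hchi : forall r, scalar (chi r))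
    (Hd : forall a : H,
       extd (incl a : Om) = \sum_r incl (fact (chi r) a) * omega r)
    (Mstar : 'I_M -> Om -> Om)
    (HMstar : forall r,
       is_adjoint (inv_forms Om) ip (fun eta => omega r * eta) (Mstar r))
    (c : 'I_M -> 'I_M -> R[i])
    (Hc : forall r s, omega r * Mstar s theta = c r s *: theta)
    (I : Type) (dim : I -> nat) (U : forall al, 'M[H]_(dim al))
    (HU : complete_family U)
    (e : forall al, 'I_(dim al) -> 'cV[R[i]]_(dim al))
    (He : forall al, orthonormal_basis setT (@cv_ip _ (dim al)) (@e al))
    (lambda : forall al, 'I_(dim al) -> R[i]) :
  let gamma (a : H) := \sum_r \sum_s c r s * fmul (chi r) (fstar (chi s)) a in
  (forall al i, map_mx gamma (U al) *m e al i = lambda al i *: e al i) ->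
  forall al (i k : 'I_(dim al)),
    let u := incl (mx_in_basis (@e al) (U al) i k) * theta in
    laplacian dstar u = lambda al k *: u.
Proof.
move=> gamma He_gamma al i k u.
have omega1 : forall r, inv_forms_deg Om 1 (omega r) by case: Homega.
have itheta : inv_forms_deg Om N theta by case: Htheta.
have lgamma : scalar gamma.
  apply: scalar_sum => r; apply: scalar_sum => s; apply: scalar_scale.
  exact/fmul_scalar/fstar_scalar.
have DU : forall p q, comul (U al p q) = \sum_l U al p l \ox U al l q.
  by case: HU => /(_ al)[[_ DU] _] _ _.
rewrite /u (laplacian_top omega1 Hd Hh HN Hclosed Hip Hgr Hleft Hdstar itheta
  Hchi HMstar _ Hc).
(* The double sum of convolutions is a single convolution by gamma, since [fact] is linear in its
   functional. *)
rewrite (_ : \sum_r _ = fact gamma (mx_in_basis (@e al) (U al) i k)).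
  rewrite (fact_mx_in_basis _ lgamma DU (He_gamma al k)).
  by rewrite (linear_atZ (@incl_linear _ _ Om)) scalerAl.
rewrite fact_sum; apply: eq_bigr => r _.
by rewrite fact_sum; apply: eq_bigr => s _; rewrite fact_scale.
Qed.
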